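(* Let $\lambda$ be a simple eigenvalue of a real Hamiltonian matrix $Q\in\mathcal H$ of size $2n\times 2n$, with corresponding right and left eigenvectors $x$ and $y$ (that is, $Qx=\lambda x$, $y^*Q=\lambda y^*$) normalized to have $$\|x\|_2=\|y\|_2=1,\qquad \operatorname{Im}(y^*Jx)\,\operatorname{Re}(y^*Jx)=\operatorname{Trace}\big(\operatorname{Re}(yx^* )^T\operatorname{Im}(yx^* )\big).$$ Given any real Hamiltonian matrix $E$ with $\|E\|_F=1$, let $\lambda_E(t)$ be an eigenvalue of $Q+tE$ converging to $\lambda$ as $t\to0$, and let $\dot\lambda_E(0)$ denote its derivative at $t=0$. Then $$|\dot\lambda_E(0)|\le\max\left\{\left|\frac{y^*Hx}{y^*x}\right|:\|H\|_F=1,\ H\in\mathcal H\right\}=\max\left\{\frac{\|\operatorname{Re}(yx^* )|_{\mathcal H}\|_F}{|y^*x|};\ \frac{\|\operatorname{Im}(yx^* )|_{\mathcal H}\|_F}{|y^*x|}\right\}.$$ Moreover: 1) if $\|\operatorname{Re}(yx^* )|_{\mathcal H}\|_F>\|\operatorname{Im}(yx^* )|_{\mathcal H}\|_F$, then $$\dot\lambda_E(0)=\frac{\|\operatorname{Re}(yx^* )|_{\mathcal H}\|_F}{y^*x}\quad\text{for}\quad E=\pm\frac{\operatorname{Re}(yx^* )|_{\mathcal H}}{\|\operatorname{Re}(yx^* )|_{\mathcal H}\|_F};$$ 2) if $\|\operatorname{Re}(yx^* )|_{\mathcal H}\|_F<\|\operatorname{Im}(yx^* )|_{\mathcal H}\|_F$,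 then $$\dot\lambda_E(0)=\frac{\|\operatorname{Im}(yx^* )|_{\mathcal H}\|_F}{y^*x}\quad\text{for}\quad E=\pm\frac{\operatorname{Im}(yx^* )|_{\mathcal H}}{\|\operatorname{Im}(yx^* )|_{\mathcal H}\|_F};$$ 3) if $\|\operatorname{Re}(yx^* )|_{\mathcal H}\|_F=\|\operatorname{Im}(yx^* )|_{\mathcal H}\|_F$, then $$\dot\lambda_E(0)=\frac{\|\operatorname{Re}(yx^* )|_{\mathcal H}\|_F}{y^*x}\quad\text{for any}\quad E=\frac{\operatorname{Re}(yx^* )|_{\mathcal H}\cos\theta+\operatorname{Im}(yx^* )|_{\mathcal H}\sin\theta}{\|\operatorname{Re}(yx^* )|_{\mathcal H}\|_F},$$ with $\theta\in[0,2\pi]$.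
   Context: $J=\begin{pmatrix}0&I_n\\-I_n&0\end{pmatrix}$ is the fundamental symplectic matrix of size $2n\times 2n$, with $I_n$ the $n\times n$ identity matrix. The linear space of real Hamiltonian matrices is $\mathcal H=\{H\in\mathbb R^{2n\times 2n}: HJ=(HJ)^T\}$. For $B\in\mathbb R^{2n\times 2n}$, put $B|_{\mathcal H}=\frac12(B+JB^TJ)$, the projection of $B$ onto $\mathcal H$. $\operatorname{Re}$ and $\operatorname{Im}$ of a complex matrix are taken entrywise, and $\operatorname{Re}(yx^* )|_{\mathcal H}$, $\operatorname{Im}(yx^* )|_{\mathcal H}$ mean the projections of the real matrices $\operatorname{Re}(yx^* )$, $\operatorname{Im}(yx^* )$. $^*$ denotes conjugate transpose, $^T$ transpose, $\|\cdot\|_F$ the Frobenius norm, and $\|\cdot\|_2$ the Euclidean norm.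
   Formalization: The derivatives in 1)–3) are corrected by unimodular factors: ±1 for E=±Re(yx* )|_H/‖·‖ in 1), ∓i for E=±Im(yx* )|_H/‖·‖ in 2), and e^{-iθ} in 3); as printed they hold only in modulus. *)

(* Defs.v *)
From HB Require Import structures.
From mathcomp Require Import all_boot all_order all_algebra.
From mathcomp Require Import complex.
From mathcomp Require Import all_classical all_reals all_analysis.

Set Implicit Arguments.
Unset Strict Implicit.
Unset Printing Implicit Defensive.

Import Order.TTheory GRing.Theory Num.Theory.
Import numFieldNormedType.Exports.

Local Open Scope classical_set_scope.
Local Open Scope ring_scope.
Local Open Scope complex_scope.
Local Open Scope sesquilinear_scope.

Section HamiltonianPerturbation.
Variable R : realType.

Definition cplxmx m p (A : 'M[R]_(m, p)) : 'M[R[i]]_(m, p) :=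
  map_mx (real_complex R) A.

Definition Remx m p (A : 'M[R[i]]_(m, p)) : 'M[R]_(m, p) :=
  map_mx (@complex.Re R) A.

Definition Immx m p (A : 'M[R[i]]_(m, p)) : 'M[R]_(m, p) :=
  map_mx (@complex.Im R) A.

Definition frobenius m p (A : 'M[R]_(m, p)) : R :=
  Num.sqrt (\sum_i \sum_j A i j ^+ 2).

Definition norm2 m (x : 'cV[R[i]]_m) : R :=
  Num.sqrt (\sum_i Normc.normc (x i 0) ^+ 2).

(* The entry of the 1 x 1 matrix y^* A x; [^t*] is the conjugate transpose. *)
Definition sform m (y : 'cV[R[i]]_m) (A : 'M[R[i]]_m) (x : 'cV[R[i]]_m)
  : R[i] := (y ^t* *m A *m x) 0 0.

Definition sdot m (y x : 'cV[R[i]]_m) : R[i] := (y ^t* *m x) 0 0.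

Definition symplJ n : 'M[R]_(n + n) := block_mx 0 1%:M (- 1%:M) 0.

Definition hamiltonian n (H : 'M[R]_(n + n)) : Prop :=
  H *m symplJ n = (H *m symplJ n)^T.

Definition hamproj n (B : 'M[R]_(n + n)) : 'M[R]_(n + n) :=
  2^-1 *: (B + symplJ n *m B^T *m symplJ n).

(* Algebraic multiplicity one. *)
Definition simple_eigenvalue m (A : 'M[R[i]]_m) (lam : R[i]) : Prop :=
  mup lam (char_poly A) = 1%N.

(* The limit is taken over full, not punctured, neighbourhoods of 0, so that
   it also says [lamE 0 = lam]. *)
Definition eigenvalue_branch m (Q E : 'M[R]_m) (lam : R[i])
    (lamE : R -> R[i]) : Prop :=
  (\forall t \near (0 : R), eigenvalue (cplxmx (Q + t *: E)) (lamE t)) /\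
  (lamE t : R[i]^o) @[t --> (0 : R)] --> (lam : R[i]^o).

(* Derivative of a complex-valued function of a real variable; the library's
   [derivable] does not apply since R[i] is not a normed module over R. *)
Definition has_derivative (f : R -> R[i]) (a : R) (d : R[i]) : Prop :=
  ((f (a + h) - f a) / h%:C : R[i]^o) @[h --> (0 : R)^'] --> (d : R[i]^o).

Definition is_max (S : set R) (M : R) : Prop := S M /\ ubound S M.

End HamiltonianPerturbation.

(* Main.v *)
(* For real H, y^*Hx = <H, Re(yx^* )> - i <H, Im(yx^* )>, and for Hamiltonian H
   both matrices may be replaced by their Hamiltonian projections A and B.  The
   normalization of x and y says exactly that A and B are orthogonal, so Bessel's
   inequality bounds |y^*Hx| by max(|A|, |B|), attained at the longer one of the
   two.  The derivative of the eigenvalue is y^*Ex / y^*x, because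
   adj(lamE t - Q - tE) x is an eigenvector of Q + tE that tends to a nonzero
   multiple of x. *)

Require Import Defs.
From HB Require Import structures.
From mathcomp Require Import all_boot all_order all_algebra.
From mathcomp Require Import complex.
From mathcomp Require Import ring lra.
From mathcomp Require Import all_classical all_reals all_analysis.

Set Implicit Arguments.
Unset Strict Implicit.
Unset Printing Implicit Defensive.

Import Order.TTheory GRing.Theory Num.Theory.
Import numFieldNormedType.Exports.

Local Open Scope classical_set_scope.
Local Open Scope ring_scope.
Local Open Scope complex_scope.
Local Open Scope sesquilinear_scope.

(** * The Frobenius inner product and Bessel's inequality *)

Definition fdot (R : realType) m p (U V : 'M[R]_(m, p)) : R := \tr (U^T *m V).

Section FrobeniusProduct.
Variables (R : realType) (m p : nat).
Implicit Types U V W : 'M[R]_(m, p).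

Lemma fdotE U V : fdot U V = \sum_i \sum_j U i j * V i j.
Proof.
rewrite /fdot /mxtrace exchange_big /=; apply: eq_bigr => j _.
by rewrite mxE; apply: eq_bigr => i _; rewrite mxE.
Qed.

Lemma fdotC U V : fdot U V = fdot V U.
Proof. by rewrite /fdot -mxtrace_tr trmx_mul trmxK. Qed.

Lemma fdotDr U V W : fdot U (V + W) = fdot U V + fdot U W.
Proof. by rewrite /fdot mulmxDr raddfD. Qed.

Lemma fdotZr a U V : fdot U (a *: V) = a * fdot U V.
Proof. by rewrite /fdot -scalemxAr mxtraceZ. Qed.

Lemma fdotDl U V W : fdot (U + V) W = fdot U W + fdot V W.
Proof. by rewrite !(fdotC _ W) fdotDr. Qed.

Lemma fdotZl a U V : fdot (a *: U) V = a * fdot U V.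
Proof. by rewrite !(fdotC _ V) fdotZr. Qed.

Lemma fdot_ge0 U : 0 <= fdot U U.
Proof. by rewrite fdotE; do 2!apply: sumr_ge0 => ? _; rewrite -expr2 sqr_ge0. Qed.

Lemma frobenius_ge0 U : 0 <= frobenius U.
Proof. exact: sqrtr_ge0. Qed.

Lemma frobenius_sqr U : frobenius U ^+ 2 = fdot U U.
Proof.
have e : fdot U U = \sum_i \sum_j U i j ^+ 2.
  by rewrite fdotE; do 2!apply: eq_bigr => ? _.
by rewrite /frobenius -e sqr_sqrtr // fdot_ge0.
Qed.

Lemma frobenius_eq1 U : fdot U U = 1 -> frobenius U = 1.
Proof.
by rewrite -frobenius_sqr => /eqP; rewrite pexpr_eq1 ?frobenius_ge0 // => /eqP.
Qed.

(* Expand [|W - (<W,U> U + <W,V> V) / r^2|^2 >= 0]. *)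
Lemma bessel2 U V W (r : R) : 0 < r -> fdot U V = 0 -> frobenius W = 1 ->
  frobenius U <= r -> frobenius V <= r ->
  fdot W U ^+ 2 + fdot W V ^+ 2 <= r ^+ 2.
Proof.
move=> r0 UV W1 Ur Vr.
have WW : fdot W W = 1 by rewrite -frobenius_sqr W1 expr1n.
have UU : fdot U U <= r ^+ 2.
  by rewrite -frobenius_sqr ler_sqr ?nnegrE ?frobenius_ge0 ?(ltW r0).
have VV : fdot V V <= r ^+ 2.
  by rewrite -frobenius_sqr ler_sqr ?nnegrE ?frobenius_ge0 ?(ltW r0).
set a := fdot W U; set b := fdot W V.
have r2 : 0 < r ^+ 2 by rewrite exprn_gt0.
have := fdot_ge0 (r ^+ 2 *: W + (- a) *: U + (- b) *: V).
rewrite !(fdotDl, fdotDr, fdotZl, fdotZr) UV (fdotC V U) UV WW.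
rewrite (fdotC U W) (fdotC V W) -/a -/b.
move: (fdot U U) (fdot V V) UU VV => u v ur vr H.
have ha : a ^+ 2 * u <= a ^+ 2 * r ^+ 2 by rewrite ler_wpM2l ?sqr_ge0.
have hb : b ^+ 2 * v <= b ^+ 2 * r ^+ 2 by rewrite ler_wpM2l ?sqr_ge0.
(* Bounding [u] and [v] by [r ^+ 2] in the expansion leaves r^2 (r^2 - a^2 - b^2) >= 0. *)
rewrite -subr_ge0 -(pmulr_rge0 _ r2); lra.
Qed.

Lemma frobenius_eq0 U : frobenius U = 0 -> U = 0.
Proof.
move=> U0; have := frobenius_sqr U; rewrite U0 expr0n /= fdotE => /esym/eqP.
have ge0 i : 0 <= \sum_j U i j * U i j.
  by apply: sumr_ge0 => j _; rewrite -expr2 sqr_ge0.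
rewrite psumr_eq0 => [/allP h|i _ //]; apply/matrixP => i j; rewrite mxE.
have := h i (mem_index_enum _); rewrite psumr_eq0 => [/allP h2|l _]; last first.
  by rewrite -expr2 sqr_ge0.
by have := h2 j (mem_index_enum _); rewrite mulf_eq0 orbb => /eqP.
Qed.

End FrobeniusProduct.

(** * Hamiltonian matrices and their orthogonal projection *)

Section Hamiltonian.
Variables (R : realType) (n : nat).
Implicit Types (H P : 'M[R]_(n + n)).
Local Notation J := (symplJ R n).

Lemma symplJ_sqr : J *m J = - 1%:M.
Proof.
rewrite /symplJ mulmx_block !mul0mx !mulmx0 !addr0 !add0r mul1mx mulmx1.
by rewrite [in RHS]scalar_mx_block opp_block_mx oppr0.
Qed.

Lemma tr_symplJ : J^T = - J.
Proof.
by rewrite /symplJ tr_block_mx opp_block_mx linearN/= !trmx0 !trmx1 !oppr0 opprK.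
Qed.

Lemma hamiltonianE H : hamiltonian H <-> J *m H^T = - (H *m J).
Proof.
rewrite /hamiltonian trmx_mul tr_symplJ mulNmx.
by split=> [->|->]; rewrite opprK.
Qed.

Lemma hamiltonianD H P : hamiltonian H -> hamiltonian P -> hamiltonian (H + P).
Proof. by rewrite /hamiltonian => h p; rewrite mulmxDl linearD/= -h -p. Qed.

Lemma hamiltonianZ a H : hamiltonian H -> hamiltonian (a *: H).
Proof. by rewrite /hamiltonian => h; rewrite -scalemxAl linearZ/= -h. Qed.

(** The map P -> J P^T J is an involution because J^2 = -1 and J^T = -J. Its fixed points are the
    Hamiltonian matrices, and [hamproj] averages P with its image. *)
Lemma hamproj_hamiltonian P : hamiltonian (hamproj P).
Proof.
apply: hamiltonianZ; apply/hamiltonianE.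
rewrite linearD/= !trmx_mul tr_symplJ trmxK mulmxDr mulmxDl.
rewrite !(mulNmx, mulmxN) opprK !mulmxA symplJ_sqr.
by rewrite -(mulmxA (J *m P^T)) symplJ_sqr mulmxN mulmx1 !mulNmx mul1mx opprB.
Qed.

(** The involution P -> J P^T J is self-adjoint for the trace form and fixes H, so both halves of
    the average pair equally with H. Thus [hamproj] is an orthogonal projection. *)
Lemma fdot_hamproj H P : hamiltonian H -> fdot H (hamproj P) = fdot H P.
Proof.
move=> /hamiltonianE hH; rewrite /hamproj fdotZr fdotDr.
have -> : fdot H (J *m P^T *m J) = fdot H P.
  rewrite /fdot !mulmxA mxtrace_mulC !mulmxA hH mulNmx -[H *m J *m J]mulmxA.
  by rewrite symplJ_sqr mulmxN mulmx1 opprK -mxtrace_tr trmx_mul trmxK mxtrace_mulC.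
lra.
Qed.

End Hamiltonian.

(** * Simple eigenvalues, the adjugate, and the pairing of left and right eigenvectors *)

(** Write the characteristic polynomial as g (X - lam); simplicity means g(lam) != 0. Over
    polynomials, (X - A) v = (X - lam) v and adj(X - A) (X - A) = g (X - lam). Cancelling X - lam
    gives adj(X - A) v = g v, and evaluation at lam yields c = g(lam). *)
Lemma simple_eigenvalue_adj_ker (F : fieldType) m (A : 'M[F]_m) (lam : F)
    (v : 'cV[F]_m) :
  mup lam (char_poly A) = 1%N -> A *m v = lam *: v ->
  exists2 c : F, c != 0 & \adj (lam%:M - A) *m v = c *: v.
Proof.
move=> hmup hv; set C := char_poly_mx A.
have p0 : char_poly A != 0 by apply: monic_neq0; exact: char_poly_monic.
have [g defp] : exists g, char_poly A = g * ('X - lam%:P).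
  apply/dvdpP; rewrite -[_ - _]expr1 -mup_geq ?hmup//.
have g_lam : g.[lam] != 0.
  apply/negP => /factor_theorem[h defg].
  have : (2 <= mup lam (char_poly A))%N.
    by rewrite mup_geq // defp defg -mulrA -expr2 dvdp_mulIr.
  by rewrite hmup.
exists g.[lam] => //.
set vp : 'cV[{poly F}]_m := map_mx polyC v.
have Cv : C *m vp = ('X - lam%:P) *: vp.
  rewrite /C /char_poly_mx mulmxBl -map_mxM hv scalerBl mul_scalar_mx.
  by congr (_ - _); apply/matrixP=> i j; rewrite !mxE rmorphM.
have adjv : \adj C *m vp = g *: vp.
  have nz : ('X - lam%:P) != 0 by rewrite polyXsubC_eq0.
  have e : ('X - lam%:P) *: (\adj C *m vp) = ('X - lam%:P) *: (g *: vp).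
    rewrite scalemxAr -Cv mulmxA mul_adj_mx mul_scalar_mx scalerA.
    by rewrite -[\det C]/(char_poly A) defp mulrC.
  apply/matrixP=> i j; move/matrixP/(_ i j): e.
  by rewrite !mxE => /(mulfI nz).
have /(congr1 (map_mx (horner_eval lam))) := adjv.
rewrite map_mxM map_mx_adj => e.
have -> : lam%:M - A = map_mx (horner_eval lam) C.
  apply/matrixP=> i j; rewrite !mxE /horner_eval !hornerE hornerMn !hornerE.
  by case: (i == j).
have -> : v = map_mx (horner_eval lam) vp.
  by apply/matrixP=> i j; rewrite !mxE /horner_eval !hornerE.
rewrite e; apply/matrixP=> i j; rewrite !mxE /horner_eval !hornerE //.
Qed.

(** Cramer's rule: expand along row k, whose cofactors do not see the replaced entries. *)
Lemma mul_row_adjE (R : comNzRingType) m (u : 'rV[R]_m) (N : 'M[R]_m) k :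
  (u *m \adj N) 0 k = \det (\matrix_(i, j) if i == k then u 0 j else N i j).
Proof.
rewrite (expand_det_row _ k) mxE; apply: eq_bigr => j _; rewrite !mxE eqxx.
congr (_ * _); rewrite /cofactor; congr (_ * \det _).
apply/matrixP=> i l; rewrite !mxE.
by rewrite eq_sym (negPf (neq_lift _ _)).
Qed.

Lemma char_poly_trmx (R : comNzRingType) m (A : 'M[R]_m) :
  char_poly A^T = char_poly A.
Proof.
rewrite /char_poly -det_tr /char_poly_mx; congr (\det _).
by rewrite linearB/= tr_scalar_mx map_trmx trmxK.
Qed.

(** Suppose u v = 0 and u_k != 0. Replacing row k of lam - A by u gives a matrix that kills v, so
    its determinant is 0. By Cramer's rule this determinant is entry k of u adj(lam - A) = c u,
    which is nonzero. *)
Lemma simple_eigenvalue_pairing_neq0 (F : fieldType) m (A : 'M[F]_m) (lam : F)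
    (u : 'rV[F]_m) (v : 'cV[F]_m) :
  mup lam (char_poly A) = 1%N -> u *m A = lam *: u -> A *m v = lam *: v ->
  u != 0 -> v != 0 -> (u *m v) 0 0 != 0.
Proof.
move=> hmup hu hv u0 v0; apply/negP => /eqP uv0.
have [k uk0] : exists k, u 0 k != 0 by apply/rV0Pn.
have [||c c0 adju] := @simple_eigenvalue_adj_ker _ _ A^T lam u^T.
- by rewrite char_poly_trmx.
- by rewrite -trmx_mul hu linearZ.
have adjuN : u *m \adj (lam%:M - A) = c *: u.
  apply: trmx_inj; rewrite trmx_mul linearZ/= -adju trmx_adj.
  by rewrite linearB/= tr_scalar_mx.
suff : (u *m \adj (lam%:M - A)) 0 k = 0.
  by move/eqP; rewrite adjuN mxE mulf_eq0 (negPf c0) (negPf uk0).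
rewrite mul_row_adjE -det_tr; apply/eqP/det0P; exists v^T.
  by rewrite -trmx0 (inj_eq (@trmx_inj _ _ _)).
rewrite -trmx_mul -[RHS]trmx0; congr (_^T).
apply/matrixP=> i j; rewrite !mxE (ord1 j).
have [ik|nik] := eqVneq i k.
  by rewrite -[RHS]uv0 [RHS]mxE; apply: eq_bigr => l _; rewrite mxE ik eqxx.
have Nv0 : ((lam%:M - A) *m v) i 0 = 0.
  by rewrite mulmxBl mul_scalar_mx hv subrr mxE.
by rewrite -[RHS]Nv0 [RHS]mxE; apply: eq_bigr => l _;
  rewrite [in LHS]mxE (negPf nik).
Qed.

(** * Entrywise limits of determinants, products and adjugates *)

Lemma cvg_det (K : numFieldType) T (F : set_system T) {FF : Filter F} m
    (N : T -> 'M[K]_m) (L : 'M[K]_m) :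
  (forall i j, N t i j @[t --> F] --> L i j) ->
  \det (N t) @[t --> F] --> \det L.
Proof.
move=> NL; rewrite /determinant.
apply: (@cvg_big K) => [|s _]; first exact: add_continuous.
apply: (@cvgM K) => //; first exact: cvg_cst.
by apply: (@cvg_big K) => //; exact: mul_continuous.
Qed.

Lemma cvg_mulmx_entry (K : numFieldType) T (F : set_system T) {FF : Filter F}
    m n p (M : T -> 'M[K]_(m, n)) (L : 'M[K]_(m, n)) (B : 'M[K]_(n, p)) i k :
  (forall i j, M t i j @[t --> F] --> L i j) ->
  (M t *m B) i k @[t --> F] --> (L *m B) i k.
Proof.
move=> ML; under eq_fun do rewrite mxE; rewrite mxE.
apply: (@cvg_big K) => [|j _]; first exact: add_continuous.
by apply: (@cvgM K) => //; exact: cvg_cst.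
Qed.

Lemma cvg_adj (K : numFieldType) T (F : set_system T) {FF : Filter F} m
    (N : T -> 'M[K]_m) (L : 'M[K]_m) :
  (forall i j, N t i j @[t --> F] --> L i j) ->
  forall i j, \adj (N t) i j @[t --> F] --> \adj L i j.
Proof.
move=> NL i j; under eq_fun do rewrite mxE; rewrite mxE.
apply: (@cvgM K); first exact: cvg_cst.
apply: cvg_det => k l; under eq_fun do rewrite !mxE; rewrite !mxE; exact: NL.
Qed.

Lemma cvg_real_complex (R : realType) (a : R) :
  (t%:C : R[i]^o) @[t --> a] --> (a%:C : R[i]^o).
Proof.
apply/cvgrPdist_lt => e e0.
(* The order on [R[i]] compares only numbers with equal imaginary parts, so a positive radius is
   real. *)
have [eR e_gt0] : e = (complex.Re e)%:C /\ 0 < complex.Re e.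
  move: e0; rewrite ltcE/= => /andP[/eqP e1 e2]; split => //.
  by case: (e) e1 => u w /= ->.
near=> t; rewrite -rmorphB normc_def/= expr0n addr0 sqrtr_sqr eR ltcR.
near: t; exact: cvgr_dist_lt.
Unshelve. all: by end_near. Qed.

(** * First-order perturbation of a simple eigenvalue *)

Lemma eigenvalue_branch_derivative (R : realType) m (Q E : 'M[R]_m)
    (lam : R[i]) (x y : 'cV[R[i]]_m) (lamE : R -> R[i]) :
  simple_eigenvalue (cplxmx Q) lam ->
  cplxmx Q *m x = lam *: x -> y ^t* *m cplxmx Q = lam *: y ^t* ->
  x != 0 -> y != 0 ->
  eigenvalue_branch Q E lam lamE ->
  has_derivative lamE 0 (sform y (cplxmx E) x / sdot y x).
Proof.
move=> hmup hx hy x0 y0 [hev hlim].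
have yt0 : y ^t* != 0.
  apply: contra_neq y0 => /matrixP yt0; apply/matrixP => i j.
  by have /eqP := yt0 j i; rewrite !mxE conjC_eq0 => /eqP ->.
have yx0 : sdot y x != 0 by exact: (simple_eigenvalue_pairing_neq0 hmup).
(* The full neighbourhoods in the limit contain 0, so the value there must be the limit. *)
have lamE0 : lamE 0 = lam.
  apply/eqP; apply/negPn/negP => ne.
  have e0 : 0 < `|lam - lamE 0| by rewrite normr_gt0 subr_eq0 eq_sym.
  have /cvgrPdist_lt/(_ _ e0)/nbhs_singleton := hlim.
  by rewrite ltxx.
have [c c0 adjx] := simple_eigenvalue_adj_ker hmup hx.
pose N t := (lamE t)%:M - cplxmx (Q + t *: E).
have NL i j : (N t i j : R[i]^o) @[t --> (0 : R)] --> ((lam%:M - cplxmx Q) i j : R[i]^o).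
  under eq_fun do rewrite !mxE rmorphD rmorphM; rewrite !mxE.
  refine (@cvgB _ R[i]^o _ _ _ (fun t => lamE t *+ (i == j))
    (fun t => (Q i j)%:C + t%:C * (E i j)%:C) _ _ _ _).
    case: (i == j); last by under eq_fun do rewrite mulr0n; exact: cvg_cst.
    exact: hlim.
  rewrite -[X in _ --> X]addr0 -[in X in _ --> _ + X](mul0r (E i j)%:C).
  apply: (@cvgD _ R[i]^o); first exact: cvg_cst.
  by apply: (@cvgM R[i]); [exact: cvg_real_complex|exact: cvg_cst].
(* An explicit kernel vector of [N t], requiring no choice of eigenvectors; its limit adj(lam - Q) x
   = c x is nonzero. *)
pose v t := \adj (N t) *m x.
have vL i j : (v t i j : R[i]^o) @[t --> (0 : R)] --> ((c *: x) i j : R[i]^o).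
  rewrite -adjx; apply: cvg_mulmx_entry; exact: cvg_adj.
(* Multiply N(t) v(t) = 0 on the left by y^*, using y^* Q = lam y^*. Differentiability of [lamE] at
   0 follows on dividing by t and y^* v(t). *)
have vN : \forall t \near (0 : R),
    (lamE t - lam) * (y ^t* *m v t) 0 0 = t%:C * (y ^t* *m cplxmx E *m v t) 0 0.
  near=> t.
  (* [eigenvalue] supplies a row vector in the left kernel; the vanishing determinant passes this to
     the right side through N adj(N) = 0. *)
  have detN : \det (N t) = 0.
    have : eigenvalue (cplxmx (Q + t *: E)) (lamE t) by near: t.
    case/eigenvalueP => u hu u0; apply/eqP/det0P; exists u => //.
    by rewrite /N mulmxBr hu mul_mx_scalar subrr.
  have Nv : N t *m v t = 0.
    by rewrite /v mulmxA mul_mx_adj detN mul_scalar_mx scale0r.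
  have yN : y ^t* *m N t = (lamE t - lam) *: y ^t* - t%:C *: (y ^t* *m cplxmx E).
    rewrite /N /cplxmx map_mxD map_mxZ mulmxBr mulmxDr hy mul_mx_scalar.
    by rewrite -scalemxAr scalerBl opprD addrA.
  have /matrixP/(_ 0 0) : y ^t* *m N t *m v t = 0 by rewrite -mulmxA Nv mulmx0.
  rewrite yN mulmxBl -!scalemxAl => /eqP.
  by rewrite mxE [X in _ + X]mxE !mxE subr_eq0 => /eqP.
(* Transposing puts the varying factor on the left, as [cvg_mulmx_entry] expects. *)
have cvgmul p (B : 'M[R[i]]_(p, m)) i :
    ((B *m v t) i 0 : R[i]^o) @[t --> (0 : R)] --> ((B *m (c *: x)) i 0 : R[i]^o).
  under eq_fun do rewrite -[_ *m _]trmxK trmx_mul mxE.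
  rewrite -[_ *m (c *: x)]trmxK trmx_mul mxE.
  apply: cvg_mulmx_entry => k l; under eq_fun do rewrite mxE.
  by rewrite mxE; exact: vL.
(* The factor c cancels in the quotient. *)
have -> : sform y (cplxmx E) x / sdot y x =
    (y ^t* *m cplxmx E *m (c *: x)) 0 0 / (y ^t* *m (c *: x)) 0 0.
  have scale00 (M : 'M[R[i]]_1) : (c *: M) 0 0 = c * M 0 0 by rewrite mxE.
  by rewrite -!scalemxAr !scale00 -mulf_div divff // mul1r.
have ycx0 : (y ^t* *m (c *: x)) 0 0 != 0.
  by rewrite -scalemxAr mxE mulf_neq0.
have yv0 : \forall t \near (0 : R), (y ^t* *m v t) 0 0 != 0.
  exact: (cvgr_neq0 (V := R[i]^o) _ (cvgmul _ _ _) ycx0).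
rewrite /has_derivative.
pose quot t : R[i]^o :=
  (y ^t* *m cplxmx E *m v t) 0 0 / (y ^t* *m v t) 0 0.
suff e : {near (0 : R)^', quot =1 fun h => (lamE (0 + h) - lamE 0) / h%:C}.
  apply: (cvg_trans (near_eq_cvg e)); apply: cvg_within_filter.
  exact: cvgM (cvgmul _ _ _) (cvgV ycx0 (cvgmul _ _ _)).
near=> t; rewrite /= add0r lamE0.
have t0 : t%:C != 0 :> R[i] by rewrite fmorph_eq0; near: t; exact: nbhs_dnbhs_neq.
have yvt : (y ^t* *m v t) 0 0 != 0 by near: t; exact: nbhs_dnbhs.
apply: (mulfI t0); rewrite [RHS]mulrCA divff // mulr1.
apply: (mulIf yvt); rewrite -mulrA /quot mulfVK //.
apply/esym; near: t; exact: nbhs_dnbhs.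
Unshelve. all: by end_near. Qed.

(** * The form y^* H x as a pair of Frobenius products *)

Section Pairing.
Variables (R : realType) (m : nat).
Implicit Types (x y : 'cV[R[i]]_m) (H : 'M[R]_m).

(** The coefficient of H_ij in y^* H x is conj(y_i) x_j, the conjugate of entry (i, j) of y x^*;
    hence the minus sign. *)
Lemma sform_real y x H :
  sform y (cplxmx H) x =
  fdot H (Remx (y *m x ^t*)) -i* fdot H (Immx (y *m x ^t*)).
Proof.
have -> : sform y (cplxmx H) x = \sum_i \sum_j (y i 0)^*%C * (H i j)%:C * x j 0.
  rewrite /sform mxE exchange_big /=; apply: eq_bigr => j _.
  rewrite mxE mulr_suml; apply: eq_bigr => i _; by rewrite !mxE.
rewrite !fdotE; apply/eqP; rewrite eq_complex /=.
rewrite !raddf_sum; apply/andP; split; apply/eqP.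
  apply: eq_bigr => i _; rewrite raddf_sum; apply: eq_bigr => j _ /=.
  rewrite !mxE big_ord1 !mxE.
  by case: (y i 0) (x j 0) => [a b] [c d] /=; ring.
apply: eq_bigr => i _ /=; rewrite !raddf_sum; apply: eq_bigr => j _ /=.
rewrite !mxE big_ord1 !mxE.
by case: (y i 0) (x j 0) => [a b] [c d] /=; ring.
Qed.

Lemma Remx_outer y x :
  Remx (y *m x ^t*) = Remx y *m (Remx x)^T + Immx y *m (Immx x)^T.
Proof.
apply/matrixP => i j; rewrite !mxE !big_ord1 !mxE.
by case: (y i 0) (x j 0) => [a b] [c d] /=; ring.
Qed.

Lemma Immx_outer y x :
  Immx (y *m x ^t*) = Immx y *m (Remx x)^T - Remx y *m (Immx x)^T.
Proof.
apply/matrixP => i j; rewrite !mxE !big_ord1 !mxE.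
by case: (y i 0) (x j 0) => [a b] [c d] /=; ring.
Qed.

Lemma mxtrace_outer (u v : 'cV[R]_m) H :
  \tr (H *m (u *m v^T)) = (v^T *m H *m u) 0 0.
Proof. by rewrite mulmxA mxtrace_mulC mulmxA trace_mx11. Qed.

Lemma mxtrace_outer2 (u v w z : 'cV[R]_m) H :
  \tr (H *m (u *m v^T) *m H *m (w *m z^T)) =
  (z^T *m H *m u) 0 0 * (v^T *m H *m w) 0 0.
Proof.
rewrite mxtrace_outer !mulmxA -(mulmxA _ v^T) -(mulmxA _ (v^T *m H)).
by rewrite mxE big_ord1.
Qed.

End Pairing.

Lemma norm2_neq0 (R : realType) m (x : 'cV[R[i]]_m) : norm2 x = 1 -> x != 0.
Proof.
move=> x1; apply: contra_eq_neq x1 => ->; rewrite /norm2 big1 ?sqrtr0 => [|i _].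
  by rewrite eq_sym oner_neq0.
by rewrite mxE Normc.normc0 expr0n.
Qed.

(** * The projected real and imaginary parts of y x^* *)

Section HamiltonianPairing.
Variables (R : realType) (n : nat) (x y : 'cV[R[i]]_(n + n)).
Local Notation J := (symplJ R n).
Local Notation A := (hamproj (Remx (y *m x ^t*))).
Local Notation B := (hamproj (Immx (y *m x ^t*))).

Lemma sform_hamiltonian (H : 'M[R]_(n + n)) : hamiltonian H ->
  sform y (cplxmx H) x = fdot H A -i* fdot H B.
Proof. by move=> hH; rewrite !fdot_hamproj // sform_real. Qed.

Lemma fdot_hamproj_outer :
  fdot A B = 2^-1 * (\tr ((Remx (y *m x ^t*))^T *m Immx (y *m x ^t*)) -
    complex.Im (sform y (cplxmx J) x) * complex.Re (sform y (cplxmx J) x)).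
Proof.
rewrite fdot_hamproj; last exact: hamproj_hamiltonian.
rewrite sform_real /= /hamproj fdotZl fdotDl; congr (_ * (_ + _)).
rewrite /fdot !trmx_mul trmxK tr_symplJ !mulNmx !mulmxN !mulNmx opprK.
rewrite !linearN/= mulNr mulrN !opprK.
(* Real rank-one summands turn every trace into a scalar or a product of two scalars. *)
rewrite Remx_outer Immx_outer !(mulmxDl, mulmxDr) !mulmxN.
rewrite !raddfD/= !raddfN/= !mulmxA.
by rewrite -!(mulmxA _ _ (_^T)) !mxtrace_outer2 !mxtrace_outer; ring.
Qed.

(* A symmetric [S] makes [S J] Hamiltonian, and [y^* S (J x)] vanishes for all
   symmetric [S] only if [y = 0] or [J x = 0]. *)
Lemma hamproj_outer_neq0 : x != 0 -> y != 0 -> ~ (A = 0 /\ B = 0).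
Proof.
move=> x0 y0 [A0 B0].
have h0 H : hamiltonian H -> sform y (cplxmx H) x = 0.
  by move=> /sform_hamiltonian ->; rewrite A0 B0 /fdot !mulmx0 mxtrace0 oppr0.
pose w := cplxmx J *m x.
have w0 : w != 0.
  apply: contra_neq x0 => w0; have : cplxmx J *m w = 0 by rewrite w0 mulmx0.
  rewrite /w mulmxA /cplxmx -map_mxM symplJ_sqr map_mxN map_mx1 mulNmx mul1mx.
  by move/eqP; rewrite oppr_eq0 => /eqP.
have yw i j : (y i 0)^*%C * w j 0 + (y j 0)^*%C * w i 0 = 0.
  pose S : 'M[R]_(n + n) := delta_mx i j + delta_mx j i.
  have hS : hamiltonian (S *m J).
    rewrite /hamiltonian -mulmxA symplJ_sqr mulmxN mulmx1 linearN/=.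
    by rewrite [S^T]linearD/= !trmx_delta [in LHS]/S addrC.
  have outer k l : (y ^t* *m cplxmx (delta_mx k l : 'M[R]_(n + n)) *m w) 0 0
      = (y k 0)^*%C * w l 0.
    rewrite mxE (bigD1 l) //= big1 ?addr0 => [|r rl]; last first.
      rewrite mxE big1 ?mul0r // => s _.
      by rewrite !mxE (negPf rl) andbF mulr0.
    rewrite mxE (bigD1 k) //= big1 ?addr0 => [|s sk]; last first.
      by rewrite !mxE (negPf sk) mulr0.
    by rewrite !mxE !eqxx mulr1.
  have := h0 _ hS; rewrite /sform /cplxmx map_mxM mulmxA -mulmxA -/w.
  by rewrite map_mxD mulmxDr mulmxDl mxE !outer.
have [j wj0] : exists j, w j 0 != 0.
  have /rV0Pn[j hj] : w^T != 0 by rewrite -trmx0 (inj_eq (@trmx_inj _ _ _)).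
  by exists j; rewrite mxE in hj.
(* Taking i = j gives 2 conj(y_j) w_j = 0; with y_j = 0, the relation for arbitrary i then gives y_i
   = 0. *)
have yj0 : (y j 0)^*%C = 0.
  have /eqP := yw j j; rewrite -mulr2n mulrn_eq0 /= mulf_eq0 (negPf wj0) orbF.
  by move/eqP.
move/eqP: y0; apply; apply/matrixP => i k; rewrite (ord1 k) mxE.
have /eqP := yw i j; rewrite yj0 mul0r addr0 mulf_eq0 (negPf wj0) orbF.
by rewrite conjc_eq0 => /eqP.
Qed.

End HamiltonianPairing.

(* The unimodular factors s, - i s and exp(- i theta) in the last
   three parts are the exact ones given by y^* E x / y^* x. *)
Theorem theorem3p1 (R : realType) (n : nat) (Q : 'M[R]_(n + n))
    (lam : R[i]) (x y : 'cV[R[i]]_(n + n))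
    (hQ : hamiltonian Q)
    (hlam : simple_eigenvalue (cplxmx Q) lam)
    (hx : cplxmx Q *m x = lam *: x)
    (hy : y ^t* *m cplxmx Q = lam *: y ^t*)
    (hx1 : norm2 x = 1) (hy1 : norm2 y = 1)
    (hnorm :
      complex.Im (sform y (cplxmx (symplJ R n)) x) *
      complex.Re (sform y (cplxmx (symplJ R n)) x) =
      \tr ((Remx (y *m x ^t*))^T *m Immx (y *m x ^t*))) :
  let A := hamproj (Remx (y *m x ^t*)) in
  let B := hamproj (Immx (y *m x ^t*)) in
  let yx := sdot y x in
  let M := Num.max (frobenius A / Normc.normc yx)
                   (frobenius B / Normc.normc yx) in
  [/\ is_max [set r | exists H : 'M[R]_(n + n),
                [/\ frobenius H = 1, hamiltonian H
                  & r = Normc.normc (sform y (cplxmx H) x / yx)]] M,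
      forall E : 'M[R]_(n + n), hamiltonian E -> frobenius E = 1 ->
        forall lamE : R -> R[i], eigenvalue_branch Q E lam lamE ->
        exists2 d : R[i], has_derivative lamE 0 d & Normc.normc d <= M,
      frobenius B < frobenius A ->
        forall s : R, s = 1 \/ s = -1 ->
        let E := s *: ((frobenius A)^-1 *: A) in
        [/\ hamiltonian E, frobenius E = 1 &
        forall lamE : R -> R[i], eigenvalue_branch Q E lam lamE ->
          has_derivative lamE 0 (s%:C * ((frobenius A)%:C / yx))],
      frobenius A < frobenius B ->
        forall s : R, s = 1 \/ s = -1 ->
        let E := s *: ((frobenius B)^-1 *: B) in
        [/\ hamiltonian E, frobenius E = 1 &
        forall lamE : R -> R[i], eigenvalue_branch Q E lam lamE ->
          has_derivative lamE 0 ((0 -i* s) * ((frobenius B)%:C / yx))]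
    & frobenius A = frobenius B ->
        forall theta : R, 0 <= theta <= 2 * pi ->
        let E := (frobenius A)^-1 *: (cos theta *: A + sin theta *: B) in
        [/\ hamiltonian E, frobenius E = 1 &
        forall lamE : R -> R[i], eigenvalue_branch Q E lam lamE ->
          has_derivative lamE 0
            ((cos theta -i* sin theta) * ((frobenius A)%:C / yx))]].
Proof.
move=> A B yx M.
have x0 := norm2_neq0 hx1; have y0 := norm2_neq0 hy1.
have AB0 : fdot A B = 0 by rewrite fdot_hamproj_outer hnorm subrr mulr0.
have hA : hamiltonian A by exact: hamproj_hamiltonian.
have hB : hamiltonian B by exact: hamproj_hamiltonian.
have BA0 : fdot B A = 0 by rewrite fdotC.
have sE H : hamiltonian H -> sform y (cplxmx H) x = fdot H A -i* fdot H B.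
  exact: sform_hamiltonian.
have AB_neq0 : ~ (A = 0 /\ B = 0) by exact: hamproj_outer_neq0.
(* From here on A and B are just two orthogonal Hamiltonian matrices, not both zero, that represent
   y^* H x. *)
clearbody A B.
have AA := frobenius_sqr A; have BB := frobenius_sqr B.
have maxAB_gt0 : 0 < Num.max (frobenius A) (frobenius B).
  rewrite lt_max !lt_neqAle !frobenius_ge0 !andbT ![0 == _]eq_sym -negb_and.
  apply/negP => /andP[/eqP/frobenius_eq0 A0 /eqP/frobenius_eq0 B0].
  exact: AB_neq0.
have dE E lamE : eigenvalue_branch Q E lam lamE ->
    has_derivative lamE 0 (sform y (cplxmx E) x / yx).
  exact: eigenvalue_branch_derivative.
have normcdiv (z : R[i]) : Normc.normc (z / yx) = Normc.normc z / Normc.normc yx.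
  by rewrite Normc.normcM Normc.normcV.
have MAB : M = Num.max (frobenius A) (frobenius B) / Normc.normc yx.
  by rewrite maxr_pMl ?invr_ge0 //; case: (yx) => a b; exact: sqrtr_ge0.
have le_M H : frobenius H = 1 -> hamiltonian H ->
    Normc.normc (sform y (cplxmx H) x / yx) <= M.
  move=> H1 hH; rewrite normcdiv MAB ler_wpM2r //.
    by rewrite invr_ge0; case: (yx) => a b; exact: sqrtr_ge0.
  (* The squared modulus is <H, A>^2 + <H, B>^2, so Bessel applies with r = max(|A|, |B|). *)
  rewrite sE //= sqrrN -ler_sqr ?nnegrE ?sqrtr_ge0 ?(ltW maxAB_gt0) // sqr_sqrtr.
    by apply: bessel2 => //; rewrite le_max lexx ?orbT.
  by rewrite addr_ge0 ?sqr_ge0.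
have unitA s : 0 < frobenius A -> s = 1 \/ s = -1 ->
    frobenius (s *: ((frobenius A)^-1 *: A)) = 1 /\
    sform y (cplxmx (s *: ((frobenius A)^-1 *: A))) x = s%:C * (frobenius A)%:C.
  move=> A_gt0 hs; split.
    apply: frobenius_eq1; rewrite !(fdotZl, fdotZr) -AA.
    by case: hs => ->; field; rewrite gt_eqF.
  rewrite sE; last by do 2!apply: hamiltonianZ.
  rewrite !fdotZl AB0 -AA -rmorphM /=; apply/eqP; rewrite eq_complex /=.
  by rewrite !mulr0 oppr0 eqxx andbT; apply/eqP; field; rewrite gt_eqF.
have unitB s : 0 < frobenius B -> s = 1 \/ s = -1 ->
    frobenius (s *: ((frobenius B)^-1 *: B)) = 1 /\
    sform y (cplxmx (s *: ((frobenius B)^-1 *: B))) x = (0 -i* s) * (frobenius B)%:C.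
  move=> B_gt0 hs; split.
    apply: frobenius_eq1; rewrite !(fdotZl, fdotZr) -BB.
    by case: hs => ->; field; rewrite gt_eqF.
  rewrite sE; last by do 2!apply: hamiltonianZ.
  rewrite !fdotZl BA0 -BB; apply/eqP; rewrite eq_complex /=.
  by apply/andP; split; apply/eqP; field; rewrite gt_eqF.
split.
- split; last by move=> r [H [H1 hH ->]]; exact: le_M.
  (* The normalized longer matrix attains the bound, since its pairing with the other one
     vanishes. *)
  rewrite MAB; have [AltB|BleA] := ltP (frobenius A) (frobenius B).
    have B_gt0 : 0 < frobenius B by apply: le_lt_trans AltB; exact: frobenius_ge0.
    have [B1 sB] := unitB 1 B_gt0 (or_introl erefl).
    eexists; split; [exact: B1|by do 2!apply: hamiltonianZ|].
    rewrite normcdiv sB; congr (_ / _).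
    by rewrite Normc.normcM /= !(expr0n, sqrrN, expr1n) /= add0r addr0 sqrtr1
      mul1r sqrtr_sqr ger0_norm // ltW.
  have A_gt0 : 0 < frobenius A by move: maxAB_gt0; rewrite max_l.
  have [A1 sA] := unitA 1 A_gt0 (or_introl erefl).
  eexists; split; [exact: A1|by do 2!apply: hamiltonianZ|].
  rewrite normcdiv sA; congr (_ / _).
  by rewrite mul1r /= expr0n /= addr0 sqrtr_sqr ger0_norm // ltW.
- move=> E hE E1 lamE /dE dlam; exists (sform y (cplxmx E) x / yx) => //.
  exact: le_M.
- move=> BA s hs E.
  have A_gt0 : 0 < frobenius A by apply: le_lt_trans BA; exact: frobenius_ge0.
  have [E1 sEA] := unitA s A_gt0 hs.
  split => //; first by do 2!apply: hamiltonianZ.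
  by move=> lamE /dE; rewrite sEA mulrA.
- move=> AB s hs E.
  have B_gt0 : 0 < frobenius B by apply: le_lt_trans AB; exact: frobenius_ge0.
  have [E1 sEB] := unitB s B_gt0 hs.
  split => //; first by do 2!apply: hamiltonianZ.
  by move=> lamE /dE; rewrite sEB mulrA.
- move=> AB theta _ E.
  have A_gt0 : 0 < frobenius A by move: maxAB_gt0; rewrite AB maxxx.
  have hE : hamiltonian E.
    by apply/hamiltonianZ/hamiltonianD; exact: hamiltonianZ.
  have A0 : frobenius A != 0 by rewrite gt_eqF.
  split => //.
    (* Orthogonality and equal norms give |A cos + B sin|^2 = |A|^2 (cos^2 + sin^2). *)
    apply: frobenius_eq1; rewrite !(fdotDl, fdotDr, fdotZl, fdotZr) AB0 BA0.
    rewrite -AA -BB -AB -[RHS](cos2Dsin2 theta); by field.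
  move=> lamE /dE; rewrite mulrA; congr (has_derivative _ _ (_ / _)).
  rewrite sE // !(fdotDl, fdotZl) AB0 BA0 -AA -BB -AB.
  by apply/eqP; rewrite eq_complex /=; apply/andP; split; apply/eqP; field.
Qed.
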